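(* Let $\mathcal{V}$ be any variety of $\mathcal{L}$-algebras such that $D\in\mathcal{V}$ and $\mathcal{V}\subseteq\mathcal{V}_0$, and let $\operatorname{F}_{\mathcal{V}}(I)$ denote the free $\mathcal{V}$-algebra on a set $I$. For every set $I$, the underlying lattice of $\operatorname{F}_{\mathcal{V}}(I)$ is a completely normal bounded distributive lattice. Moreover, if $\operatorname{card} I\geq\aleph_2$, then (the underlying lattice of) $\operatorname{F}_{\mathcal{V}}(I)$ is not a homomorphic image of any $\ell$-representable lattice.
   Context: A distributive lattice with zero is completely normal if for all elements $a,b$ there are $x,y$ with $a\vee b=a\vee y=x\vee b$ and $x\wedge y=0$. An $\ell$-group is a group with a translation-invariant lattice ordering. An $\ell$-ideal of an Abelian $\ell$-group $G$ is a subgroup that is also an order-convex sublattice. $\operatorname{Id}^{\ell}_{\mathrm c}G$ denotes the distributive lattice of all finitely generated $\ell$-ideals of $G$, ordered by inclusion. A lattice is $\ell$-representable if it is isomorphic to $\operatorname{Id}^{\ell}_{\mathrm c}G$ for some Abelian $\ell$-group $G$. Let $\mathcal{L}=(\vee,\wedge,\smallsetminus,0,1)$ with $\vee,\wedge,\smallsetminus$ binary operation symbols and $0,1$ constants. $\mathcal{V}_0$ is the variety of $\mathcal{L}$-structures defined by the identities of bounded distributive lattices for $(\vee,\wedge,0,1)$ together with $(x\wedge y)\vee(x\smallsetminus y)=x$ and $(x\smallsetminus y)\wedge(y\smallsetminus x)=0$. The cube. Let $\mathbf{2}=\{0,1\}$ and $\mathbf{3}=\{0,1,2\}$ be chains with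 their natural order. Put $\overline{0}=0$, $\overline{1}=\overline{2}=2$. Let $\boldsymbol{e}\colon\mathbf{2}\to\mathbf{3}$, $0\mapsto0$, $1\mapsto2$; let $\boldsymbol{r}\colon\mathbf{3}\to\mathbf{2}$ send $0$ to $0$ and $1,2$ to $1$. Define $\boldsymbol{f},\boldsymbol{g}\colon\mathbf{3}\to\mathbf{3}^2$ by $\boldsymbol{f}(x)=(\overline{x},x)$, $\boldsymbol{g}(x)=(x,\overline{x})$, and $\boldsymbol{a},\boldsymbol{b},\boldsymbol{c}\colon\mathbf{3}^2\to\mathbf{3}^3\times\mathbf{2}$ by $\boldsymbol{a}(x,y)=(\overline{x},x,y,\boldsymbol{r}(y))$, $\boldsymbol{b}(x,y)=(x,\overline{x},y,\boldsymbol{r}(x))$, $\boldsymbol{c}(x,y)=(x,y,\overline{y},\boldsymbol{r}(y))$. Consider the commutative diagram of bounded lattice embeddings indexed by the subsets of $\{1,2,3\}$, with $D_{\varnothing}=\mathbf{2}$, $D_1=D_2=D_3=\mathbf{3}$, $D_{1,2}=D_{1,3}=D_{2,3}=\mathbf{3}^2$, $D_{1,2,3}=\mathbf{3}^3\times\mathbf{2}$, and arrows: $\boldsymbol{e}\colon D_\varnothing\to D_i$ for $i=1,2,3$; $\boldsymbol{f}\colon D_1\to D_{1,2}$, $\boldsymbol{f}\colon D_1\to D_{1,3}$, $\boldsymbol{g}\colon D_2\to D_{1,2}$, $\boldsymbol{f}\colon D_2\to D_{2,3}$, $\boldsymbol{g}\colon D_3\to D_{1,3}$, $\boldsymbol{g}\colon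 D_3\to D_{2,3}$; $\boldsymbol{a}\colon D_{1,2}\to D_{1,2,3}$, $\boldsymbol{b}\colon D_{1,3}\to D_{1,2,3}$, $\boldsymbol{c}\colon D_{2,3}\to D_{1,2,3}$. Binary operations $\smallsetminus$ can be chosen on all the lattices $D_p$ ($p\subseteq\{1,2,3\}$) so that every $D_p$ becomes a member of $\mathcal{V}_0$ and all the arrows of the diagram become embeddings of $\mathcal{L}$-structures. Fix such a choice, and let $D=D_{1,2,3}=(\mathbf{3}^3\times\mathbf{2},\vee,\wedge,\smallsetminus,0,1)$ be the resulting $\mathcal{L}$-structure. *)

(* Defs.v *)
From HB Require Import structures.
From mathcomp Require Import all_boot all_order all_algebra.
From mathcomp Require Import all_classical.

Set Implicit Arguments.
Unset Strict Implicit.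
Unset Printing Implicit Defensive.

Import Order.TTheory GRing.Theory Num.Theory.

Local Open Scope classical_set_scope.
Local Open Scope card_scope.

(** * Abelian l-groups and representable lattices *)

(* MathComp already ties [GRing.Zmodule] and [Order.Lattice] together in the
   totally ordered [Num.RealDomain], which prevents a structure inheriting from
   both; the lattice operations are therefore added on top of
   [Num.POrderedZmodule], a group with an unrelated partial order. *)
HB.mixin Record isAbLgroup G of Num.POrderedZmodule G := {
  lg_join : G -> G -> G;
  lg_meet : G -> G -> G;
  lg_leUx : forall x y z : G, (lg_join x y <= z)%R = (x <= z)%R && (y <= z)%R;
  lg_lexI : forall x y z : G, (z <= lg_meet x y)%R = (z <= x)%R && (z <= y)%R;
  lg_lerD2l : forall z x y : G, (x <= y)%R -> (z + x <= z + y)%R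
}.

#[short(type="abLgroupType")]
HB.structure Definition AbLgroup := { G of Num.POrderedZmodule G & isAbLgroup G }.

Record l_ideal (G : abLgroupType) (J : set G) : Prop := {
  l_ideal0 : J 0%R;
  l_idealB : forall x y, J x -> J y -> J (x - y)%R;
  l_ideal_join : forall x y, J x -> J y -> J (lg_join x y);
  l_ideal_meet : forall x y, J x -> J y -> J (lg_meet x y);
  l_ideal_convex : forall x y z, J x -> J z -> (x <= y <= z)%R -> J y
}.

Definition fg_l_ideal (G : abLgroupType) (J : set G) : Prop :=
  exists2 S : set G, finite_set S & J = smallest (@l_ideal G) S.

Record Idc (G : abLgroupType) := MkIdc {
  idc_set :> set G;
  idc_fg : `[< fg_l_ideal idc_set >]
}.

(* The order on [set G] is inclusion, hence so is the one on [Idc G]. *)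
HB.instance Definition _ (G : abLgroupType) := [isSub for @idc_set G].
HB.instance Definition _ (G : abLgroupType) := [Choice of Idc G by <:].
HB.instance Definition _ (G : abLgroupType) :=
  [SubChoice_isSubPOrder of Idc G by <: with set_display].

Lemma le_idcE (G : abLgroupType) (J K : Idc G) :
  (J <= K)%O <-> idc_set J `<=` idc_set K.
Proof. by rewrite -subsetEset. Qed.

(* A bijection between a lattice and a poset that preserves and reflects the
   order is an isomorphism of lattices. *)
Definition l_representable d (L : latticeType d) : Prop :=
  exists (G : abLgroupType) (phi : L -> Idc G),
    bijective phi /\ {mono phi : x y / (x <= y)%O}.

(** * Algebras over the signature (join, meet, diff, 0, 1) *)

Record lAlg := MkLAlg {
  lcarrier :> Type;
  ljoin : lcarrier -> lcarrier -> lcarrier;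
  lmeet : lcarrier -> lcarrier -> lcarrier;
  ldiff : lcarrier -> lcarrier -> lcarrier;
  lbot : lcarrier;
  ltop : lcarrier
}.

Arguments lbot {_}.
Arguments ltop {_}.

Record lhom (A B : lAlg) (h : A -> B) : Prop := {
  lhom_join : forall x y, h (ljoin x y) = ljoin (h x) (h y);
  lhom_meet : forall x y, h (lmeet x y) = lmeet (h x) (h y);
  lhom_diff : forall x y, h (ldiff x y) = ldiff (h x) (h y);
  lhom_bot : h lbot = lbot;
  lhom_top : h ltop = ltop
}.

Definition lembedding (A B : lAlg) (h : A -> B) : Prop :=
  lhom h /\ injective h.

Inductive lterm (X : Type) :=
| TVar of X
| TJoin of lterm X & lterm X
| TMeet of lterm X & lterm X
| TDiff of lterm X & lterm X
| TBot
| TTop.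

Fixpoint leval (X : Type) (A : lAlg) (v : X -> A) (t : lterm X) : A :=
  match t with
  | TVar x => v x
  | TJoin s t => ljoin (leval v s) (leval v t)
  | TMeet s t => lmeet (leval v s) (leval v t)
  | TDiff s t => ldiff (leval v s) (leval v t)
  | TBot => lbot
  | TTop => ltop
  end.

Definition lsatisfies (A : lAlg) (s t : lterm nat) : Prop :=
  forall v : nat -> A, leval v s = leval v t.

(* Classes of algebras are plain predicates rather than [set lAlg], so as not
   to force the carriers to live below the universe of [set]. *)
Definition is_variety (V : lAlg -> Prop) : Prop :=
  exists E : lterm nat -> lterm nat -> Prop,
    forall A : lAlg, V A <-> (forall s t, E s t -> lsatisfies A s t).

Definition is_free (V : lAlg -> Prop) (I : Type) (F : lAlg) (eta : I -> F)
    : Prop :=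
  V F /\
  forall (A : lAlg) (f : I -> A), V A ->
    exists! h : F -> A, lhom h /\ (forall i, h (eta i) = f i).

Record bounded_distributive_lattice (A : lAlg) : Prop := {
  bdl_joinA : forall x y z : A, ljoin x (ljoin y z) = ljoin (ljoin x y) z;
  bdl_joinC : forall x y : A, ljoin x y = ljoin y x;
  bdl_joinK : forall x y : A, ljoin x (lmeet x y) = x;
  bdl_meetA : forall x y z : A, lmeet x (lmeet y z) = lmeet (lmeet x y) z;
  bdl_meetC : forall x y : A, lmeet x y = lmeet y x;
  bdl_meetK : forall x y : A, lmeet x (ljoin x y) = x;
  bdl_meetDr : forall x y z : A,
    lmeet x (ljoin y z) = ljoin (lmeet x y) (lmeet x z);
  bdl_join0 : forall x : A, ljoin lbot x = x;
  bdl_meet1 : forall x : A, lmeet ltop x = x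
}.

Definition completely_normal (A : lAlg) : Prop :=
  forall a b : A, exists x y : A,
    [/\ ljoin a b = ljoin a y, ljoin a y = ljoin x b & lmeet x y = lbot].

Record variety0 (A : lAlg) : Prop := {
  variety0_lattice : bounded_distributive_lattice A;
  variety0_diff : forall x y : A, ljoin (lmeet x y) (ldiff x y) = x;
  variety0_diffI : forall x y : A, lmeet (ldiff x y) (ldiff y x) = lbot
}.

(* Preservation of least elements would follow from surjectivity. *)
Definition homomorphic_image d (L : latticeType d) (A : lAlg) : Prop :=
  exists h : L -> A,
    [/\ forall x y, h (Order.join x y) = ljoin (h x) (h y),
        forall x y, h (Order.meet x y) = lmeet (h x) (h y)
      & forall z, exists x, h x = z].

(** * The cube of finite lattices *)

(* The library equips ['I_n.+1] with its total order and with its bounds, but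
   not with the structures combining the two; this line adds these joins. *)
HB.instance Definition _ (n : nat) := Order.Total.on 'I_n.+1.

(* [*p] is the product with the componentwise order. *)
Notation chain2 := 'I_2.
Notation chain3 := 'I_3.
Notation chain3sq := (chain3 *p chain3)%type.
Notation chain3cube2 := (chain3 *p chain3 *p chain3 *p chain2)%type.

Definition overline (x : chain3) : chain3 :=
  if x == ord0 then ord0 else ord_max.
Definition cube_e (x : chain2) : chain3 :=
  if x == ord0 then ord0 else ord_max.
Definition cube_r (x : chain3) : chain2 :=
  if x == ord0 then ord0 else ord_max.
Definition cube_f (x : chain3) : chain3sq := (overline x, x).
Definition cube_g (x : chain3) : chain3sq := (x, overline x).
Definition cube_a (p : chain3sq) : chain3cube2 :=
  let: (x, y) := p in (overline x, x, y, cube_r y).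
Definition cube_b (p : chain3sq) : chain3cube2 :=
  let: (x, y) := p in (x, overline x, y, cube_r x).
Definition cube_c (p : chain3sq) : chain3cube2 :=
  let: (x, y) := p in (x, y, overline y, cube_r y).

Definition lattice_lAlg d (T : tbDistrLatticeType d) (sd : T -> T -> T) : lAlg :=
  MkLAlg (@Order.join d T) (@Order.meet d T) sd (\bot)%O (\top)%O.

(* [sd], [sd1], ..., [sd123] are the operations on the lattices indexed by the
   empty set, {1}, ..., {1,2,3}; lattices that coincide may carry different
   operations. *)
Record cube_expansion := {
  sd : chain2 -> chain2 -> chain2;
  sd1 : chain3 -> chain3 -> chain3;
  sd2 : chain3 -> chain3 -> chain3;
  sd3 : chain3 -> chain3 -> chain3;
  sd12 : chain3sq -> chain3sq -> chain3sq;
  sd13 : chain3sq -> chain3sq -> chain3sq;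
  sd23 : chain3sq -> chain3sq -> chain3sq;
  sd123 : chain3cube2 -> chain3cube2 -> chain3cube2;
  sd_variety0 : variety0 (lattice_lAlg sd);
  sd1_variety0 : variety0 (lattice_lAlg sd1);
  sd2_variety0 : variety0 (lattice_lAlg sd2);
  sd3_variety0 : variety0 (lattice_lAlg sd3);
  sd12_variety0 : variety0 (lattice_lAlg sd12);
  sd13_variety0 : variety0 (lattice_lAlg sd13);
  sd23_variety0 : variety0 (lattice_lAlg sd23);
  sd123_variety0 : variety0 (lattice_lAlg sd123);
  emb_0_1 : @lembedding (lattice_lAlg sd) (lattice_lAlg sd1) cube_e;
  emb_0_2 : @lembedding (lattice_lAlg sd) (lattice_lAlg sd2) cube_e;
  emb_0_3 : @lembedding (lattice_lAlg sd) (lattice_lAlg sd3) cube_e;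
  emb_1_12 : @lembedding (lattice_lAlg sd1) (lattice_lAlg sd12) cube_f;
  emb_1_13 : @lembedding (lattice_lAlg sd1) (lattice_lAlg sd13) cube_f;
  emb_2_12 : @lembedding (lattice_lAlg sd2) (lattice_lAlg sd12) cube_g;
  emb_2_23 : @lembedding (lattice_lAlg sd2) (lattice_lAlg sd23) cube_f;
  emb_3_13 : @lembedding (lattice_lAlg sd3) (lattice_lAlg sd13) cube_g;
  emb_3_23 : @lembedding (lattice_lAlg sd3) (lattice_lAlg sd23) cube_g;
  emb_12_123 : @lembedding (lattice_lAlg sd12) (lattice_lAlg sd123) cube_a;
  emb_13_123 : @lembedding (lattice_lAlg sd13) (lattice_lAlg sd123) cube_b;
  emb_23_123 : @lembedding (lattice_lAlg sd23) (lattice_lAlg sd123) cube_c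
}.

Definition cube_top (c : cube_expansion) : lAlg := lattice_lAlg (sd123 c).

(** * Cardinality at least aleph_2 *)

Definition card_lt (A B : Type) : Prop :=
  ([set: A] #<= [set: B]) /\ ~ ([set: B] #<= [set: A]).

Definition succ_card (A B : Type) : Prop :=
  card_lt A B /\ forall C : Type, card_lt A C -> [set: B] #<= [set: C].

(* aleph_(n+1) is the successor cardinal of aleph_n. *)
Definition card_ge_aleph2 (I : Type) : Prop :=
  exists A1 A2 : Type,
    [/\ succ_card nat A1, succ_card A1 A2 & [set: A2] #<= [set: I]].

(* Main.v *)
(** A homomorphic image of an l-representable lattice carries an operation [d]
    with [x <= y \/ d(x, y)], [d(x, y) /\ d(y, x) = 0] and
    [d(x, z) <= d(x, y) \/ d(y, z)], induced by [(x - y)^+] on positive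
    generators of principal l-ideals.  On the free algebra, each [d(i, j)], for
    generators [i] and [j], involves finitely many generators only; by
    Kuratowski's free set theorem, at least [aleph_2] generators yield distinct
    [i, j, k] such that none of them is involved in the two differences of the
    other two.  Mapping [i, j, k] to the elements [1] of [D_1, D_2, D_3] and all
    other generators to [0], the differences are sent to the images of
    [D_{1,2}], [D_{1,3}] and [D_{2,3}] in [D], where the first two properties
    determine their last coordinates, which contradict the third one. *)

Require Import Defs.
From mathcomp Require Import all_boot all_order all_algebra.
From mathcomp Require Import all_classical wochoice.
From Stdlib Require Import Inverse_Image.

Set Implicit Arguments.
Unset Strict Implicit.
Unset Printing Implicit Defensive.

Import Order.TTheory GRing.Theory.

Local Open Scope classical_set_scope.
Local Open Scope card_scope.

(** * Uncountable sets *)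

Record strict_well_order (T : Type) (R : T -> T -> Prop) : Prop := {
  swo_wf : well_founded R;
  swo_total : forall x y, x <> y -> R x y \/ R y x;
  swo_trans : forall x y z, R x y -> R y z -> R x z
}.

Lemma card_le_setTP (T U : Type) :
  ([set: T] #<= [set: U]) <-> exists f : T -> U, injective f.
Proof.
split=> [|[f injf]]; last first.
  by apply/inj_card_le/unsquash/injfunPex; exists f => // x y _ _ /injf.
elim/Ppointed: U => U.
  rewrite emptyE => /eqP T0.
  have noT (x : T) : False by have : [set: T] x by []; rewrite T0.
  by exists (fun x => False_rect _ (noT x)) => x; case: (noT x).
by move=> /pcard_injP[f injf]; exists f => x y; apply: injf; rewrite inE.
Qed.

Lemma strict_well_order_exists (T : Type) :
  exists R : T -> T -> Prop, strict_well_order R.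
Proof.
have [R wR] := well_ordering_principle {classic T}.
have minR (P : T -> Prop) : (exists x, P x) ->
    exists2 z, P z & forall x, P x -> R z x.
  case=> x Px.
  have [|z [[Pz lbz] _]] := wR [pred x | `[<P x>]].
    by exists x; apply/asboolP.
  exists z; first exact/asboolP.
  by move=> y Py; apply: lbz; apply/asboolP.
(* Least elements are unique, and under both hypotheses [x] and [y] are each least in [{x, y}];
   [Rxx] comes from singletons. *)
have anti x y : R x y -> R y x -> x = y.
  move=> Rxy Ryx.
  have Rxx u : R u u by have [|z <- ->] := minR (eq u); first exists u.
  have [|z [_ uz]] := wR [pred u : {classic T} | `[<u = x \/ u = y>]].
    by exists x; apply/asboolP; left.
  have zx : z = x by apply: uz; split=> [|u /asboolP[]->//]; apply/asboolP; left.
  have zy : z = y by apply: uz; split=> [|u /asboolP[]->//]; apply/asboolP; right.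
  by rewrite -zx.
have wf_min (P : T -> Prop) x : P x ->
    exists2 z, P z & forall y, P y -> y <> z -> ~ R y z.
  move=> Px; have [|z Pz zle] := minR P; first by exists x.
  by exists z => // y Py yz Ryz; apply: yz; apply: anti (zle _ Py).
exists (fun x y => R x y /\ x <> y); split.
- move=> x; apply: contrapT => nx.
  have [z nz minz] := wf_min (fun x => ~ Acc (fun x y => R x y /\ x <> y) x) x nx.
  apply: nz; split=> y [Ryz yz]; apply: contrapT => ny.
  exact: minz Ryz.
- move=> x y xy.
  have [|z [] -> lez] := minR (fun u => u = x \/ u = y); first by exists x; left.
  + by left; split=> //; apply: lez; right.
  + by right; split=> [|/esym//]; apply: lez; left.
(* The least element of [{x, y, z}] can only be [x]: were it [y] or [z], antisymmetry would give
   [x = y] or [y = z]. *)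
- move=> x y z [Rxy xy] [Ryz yz].
  have [|u [->|[]->] leu] := minR (fun u => u = x \/ u = y \/ u = z).
  + by exists x; left.
  + split; first by apply: leu; right; right.
    by move=> xz; apply: yz; apply: anti => //; rewrite -xz.
  + by case: xy; apply: anti => //; apply: leu; left.
  + by case: yz; apply: anti => //; apply: leu; right; left.
Qed.

Lemma countable_image (T U : Type) (f : T -> U) (A : set T) :
  countable A -> countable (f @` A).
Proof. by apply: sub_countable; apply: card_image_le. Qed.

Lemma countable_preimage_inj (T U : Type) (f : T -> U) (A : set U) :
  injective f -> countable A -> countable (f @^-1` A).
Proof.
move=> injf /countable_injP[g injg]; apply/countable_injP; exists (g \o f).
move=> x y; rewrite !inE => Ax Ay /= /injg fxy; apply: injf.
by apply: fxy; rewrite inE.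
Qed.

(* Choose [f x] by recursion outside the countable set of the previous values. *)
Lemma card_le_countable_segments (X Y : Type) (R : X -> X -> Prop) :
    well_founded R -> (forall x y, x <> y -> R x y \/ R y x) ->
    (forall y, countable [set x | R x y]) -> ~ countable [set: Y] ->
  exists f : X -> Y, injective f.
Proof.
move=> wfR totR segR unY.
have fresh (A : set Y) : countable A -> exists y, ~ A y.
  move=> cA; apply: contrapT => /forallNP allA; apply: unY.
  by rewrite -(_ : A = setT)// -subTset => y _; apply: contrapT.
have [y0 _] := fresh set0 (countable0 _).
pose prev x (rec : forall x', R x' x -> Y) : set Y :=
  [set y | exists x' (h : R x' x), rec x' h = y].
(* The default [y0] makes the recursion step total; in [fP] the lemma [fresh] excludes that
   branch. *)
pose step x rec := if pselect (exists y, ~ prev x rec y) is left h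
  then projT1 (cid h) else y0.
pose f := Fix wfR (fun _ => Y) step.
have fE x : f x = step x (fun x' _ => f x').
  rewrite /f Fix_eq// => z g h gh; congr step.
  by apply: functional_extensionality_dep => u;
     apply: functional_extensionality_dep => v.
have fP x x' : R x' x -> f x' <> f x.
  move=> Rx; rewrite [f x]fE /step; case: pselect => [h|[]].
    by move=> fx'; apply: (projT2 (cid h)); exists x', Rx.
  apply: fresh; apply: sub_countable (countable_image f (segR x)).
  by apply: subset_card_le => y [u [Ru <-]]; exists u.
exists f => x y fxy; apply: contrapT => /totR[] /fP; first exact.
by apply; rewrite fxy.
Qed.

(** A copy of omega_1 inside [A]: well-order [A] and cut at the least point whose initial segment is
    uncountable, if there is one. *)
Lemma uncountable_countable_segments (A : Type) : ~ countable [set: A] ->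
  exists (T : Type) (R : T -> T -> Prop) (e : T -> A),
  [/\ strict_well_order R, forall y, countable [set x | R x y],
      ~ countable [set: T] & injective e].
Proof.
move=> unA; have [R woR] := strict_well_order_exists A.
case: (pselect (exists a, ~ countable [set x | R x a])) => [|allc]; last first.
  exists A, R, id; split=> // y; apply: contrapT => unc; apply: allc.
  by exists y.
pose P a := ~ countable [set x | R x a].
case=> a Pa.
have {a Pa} [a Pa mina] : exists2 a, P a & forall b, R b a -> ~ P b.
  elim/(well_founded_ind (swo_wf woR)): a Pa => a IH Pa.
  have [[b [Rba Pb]]|h] := pselect (exists b, R b a /\ P b); first exact: IH Pb.
  by exists a => // b Rba Pb; apply: h; exists b.
pose T := {x : A | R x a}.
have injv : injective (@proj1_sig A (fun x => R x a)).
  by move=> [x hx] [y hy] /= xy; apply: eq_exist.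
exists T, (fun x y => R (proj1_sig x) (proj1_sig y)), (@proj1_sig _ _).
split; last exact: injv.
- split.
  + by apply: (wf_inverse_image _ _ _ (@proj1_sig _ _)); exact: swo_wf.
  + by move=> x y xy; apply: swo_total => // /injv.
  + by move=> x y z; apply: swo_trans.
- move=> [y Ry]; apply: (@countable_preimage_inj _ _ _ [set x | R x y] injv).
  by apply: contrapT; exact: mina Ry.
- move=> cT; apply: Pa.
  apply: sub_countable (countable_image (@proj1_sig _ _) cT).
  by apply: subset_card_le => x Rxa; exists (exist _ x Rxa).
Qed.

(** The cardinal equality aleph_1 * aleph_1 * aleph_0 = aleph_1, in the form in which triples will
    code elements of finite sets indexed by pairs. *)
Lemma countable_segments_square_inj (T : Type) (R : T -> T -> Prop) :
    strict_well_order R -> (forall y, countable [set x | R x y]) ->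
    ~ countable [set: T] ->
  exists f : T * T * nat -> T, injective f.
Proof.
move=> woR segR unT.
have [W woW] := strict_well_order_exists (T * T * nat).
pose m (p : T * T * nat) := if `[<R p.1.1 p.1.2>] then p.1.2 else p.1.1.
pose le x y := R x y \/ x = y.
have leS y : countable [set x | le x y].
  rewrite (_ : mkset _ = [set x | R x y] `|` [set y])//.
  rewrite -bigcup2E.
  apply: bigcup_countable => // -[|[|n]] _ //=; exact: countable1.
have le_trans x y z : le x y -> le y z -> le x z.
  by move=> [Rxy|->]// [Ryz|<-]; left=> //; apply: swo_trans Rxy Ryz.
have le1 p : le p.1.1 (m p).
  by rewrite /m; case: asboolP => h; [left|right].
have le2 p : le p.1.2 (m p).
  rewrite /m; case: asboolP => [|h]; first by right.
  by have [->|/(swo_total woR)[]//] := EM (p.1.2 = p.1.1); [right|left].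
(* As in Gödel's pairing, triples are compared first by the maximum [m] of their entries in [T].
   Ties may be broken by an arbitrary well-order [W], because only countably many triples have
   maximum at most [m q]. *)
pose Q p q := R (m p) (m q) \/ (m p = m q /\ W p q).
apply: (@card_le_countable_segments _ _ Q); last exact: unT.
- move=> p; move: {2}(m p) (erefl (m p)) => a.
  elim/(well_founded_ind (swo_wf woR)): a p => a IHa p.
  elim/(well_founded_ind (swo_wf woW)): p => p IHp mp.
  split=> q [Rq|[mq Wq]]; last by apply: IHp => //; rewrite mq.
  by apply: IHa (erefl _); rewrite -mp.
- move=> p q pq.
  have [mpq|/(swo_total woR)[Rm|Rm]] := EM (m p = m q); last 2 first.
  + by left; left.
  + by right; left.
  + by have [Wpq|Wqp] := swo_total woW pq; [left|right]; right.
- move=> q; pose S := [set x | le x (m q)].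
  have cS : countable (S `*` S `*` [set: nat]).
    apply: countableX; last exact: countableP.
    by apply: countableX; exact: leS.
  apply: sub_countable cS; apply: subset_card_le => p /= Qpq.
  have lepq : le (m p) (m q) by case: Qpq => [|[]]; [left|right].
  by split=> //; split; [exact: le_trans (le1 p) _|exact: le_trans (le2 p) _].
Qed.

(* The case n = 2 of Kuratowski's free set theorem. *)
Lemma free_triple (I : Type) (P : I -> I -> set I) :
    card_ge_aleph2 I -> (forall x y, finite_set (P x y)) ->
  exists i j k, [/\ ~ P i j k, ~ P i k j & ~ P j k i].
Proof.
case=> A1 [A2 [[[_ unA1] _] [[/card_le_setTP[g injg] ltA] _]]].
move=> /card_le_setTP[h injh] finP.
have [T [R [e [woR segR unT inje]]]] := uncountable_countable_segments unA1.
have [s injs] := countable_segments_square_inj woR segR unT.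
pose m := h \o g \o e.
have injm : injective m by move=> x y /injh/injg/inje.
(* Otherwise each [h a] lies in some finite set [P (m x) (m y)]. Then [x], [y] and the position of
   [h a] in that set determine [a], so [A2] injects into [T * T * nat], hence into [A1]. *)
have [k kP] : exists k, forall x y, ~ P (m x) (m y) k.
  apply: contrapT => /forallNP allk; apply: ltA.
  have code x y : {c : I -> nat | {in P x y &, injective c}}.
    by apply/cid/countable_injP/finite_set_countable.
  have /choice[u uP] a : exists xy, P (m xy.1) (m xy.2) (h a).
    apply: contrapT => /forallNP nxy; apply: (allk (h a)) => x y.
    exact: (nxy (x, y)).
  apply/card_le_setTP.
  exists (e \o s \o (fun a => (u a, projT1 (code (m (u a).1) (m (u a).2)) (h a)))).
  move=> a b /inje/injs [uab]; rewrite -uab => cab; apply: injh.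
  by apply: (projT2 (code _ _)) cab; rewrite inE// uab.
(* With [k] fixed, [j] is taken outside the countable union of the sets [Q i] for [i] in [N]; then
   the infinite set [N] has a member [i] outside the finite set [Q j]. *)
have [N [cN infN]] : exists N : set T, countable N /\ infinite_set N.
  have /infiniteP/card_le_setTP[f injf] : infinite_set [set: T].
    by move=> /finite_set_countable.
  exists (range f); split; first exact: countable_image.
  rewrite infiniteP (card_le_eqr (inj_card_eq _))//.
  by move=> x y _ _ /injf.
pose Q i := [set x | P (m i) k (m x)].
have cU : countable (\bigcup_(i in N) Q i).
  apply: bigcup_countable => // i _.
  by apply: (@countable_preimage_inj _ _ m (P (m i) k)) => //; exact: finite_set_countable.
have [j jU] : exists j, ~ (\bigcup_(i in N) Q i) j.
  apply: contrapT => /forallNP allj; apply: unT.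
  by rewrite -(_ : \bigcup_(i in N) Q i = setT)// -subTset => y _; apply: contrapT.
have finQ : finite_set (Q j).
  by apply: finite_preimage => // x y _ _ /injm.
have [i [Ni Qi]] : exists i, N i /\ ~ Q j i.
  apply: contrapT => /forallNP alli; apply: infN.
  apply: sub_finite_set finQ => i Ni; apply: contrapT => Qi.
  by apply: (alli i).
exists (m i), (m j), k; split=> //.
by move=> Pij; apply: jU; exists i.
Qed.

(** * Principal l-ideals *)

Section AbelianLGroup.
Local Open Scope ring_scope.
Variable G : abLgroupType.
Implicit Types x y z u v : G.

(** * Positive parts and disjoint elements *)

Definition pos_part x := lg_join x 0.

Lemma lg_lerD2lE z x y : (z + x <= z + y) = (x <= y).
Proof.
apply/idP/idP => [h|]; last exact: lg_lerD2l.
by rewrite -(addKr z x) -(addKr z y); apply: lg_lerD2l.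
Qed.

Lemma lg_lerD x y u v : x <= y -> u <= v -> x + u <= y + v.
Proof.
move=> xy uv; apply: (@le_trans _ _ (x + v)); first exact: lg_lerD2l.
by rewrite ![_ + v]addrC; apply: lg_lerD2l.
Qed.

Lemma lg_lerBlDl x y z : (x - y <= z) = (x <= y + z).
Proof. by rewrite -(lg_lerD2lE y (x - y)) [y + (x - y)]addrC subrK. Qed.

Lemma lg_lerBrDl x y z : (x <= z - y) = (y + x <= z).
Proof. by rewrite -(lg_lerD2lE y x) [y + (z - y)]addrC subrK. Qed.

Lemma lg_lerNl x y : (- x <= y) = (- y <= x).
Proof. by rewrite -[- x]add0r -[- y]add0r !lg_lerBlDl addrC. Qed.

Lemma lg_addr_ge0 x y : 0 <= x -> 0 <= y -> 0 <= x + y.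
Proof. by move=> x0 y0; rewrite -[0]addr0; apply: lg_lerD. Qed.

Lemma lg_mulrn_ge0 x n : 0 <= x -> 0 <= x *+ n.
Proof.
by move=> x0; elim: n => [|n IH]; rewrite ?mulr0n// mulrS lg_addr_ge0.
Qed.

Lemma le_pos_part x : x <= pos_part x.
Proof. by have := lexx (pos_part x); rewrite {1}/pos_part lg_leUx => /andP[]. Qed.

Lemma pos_part_ge0 x : 0 <= pos_part x.
Proof. by have := lexx (pos_part x); rewrite {1}/pos_part lg_leUx => /andP[]. Qed.

Lemma pos_part_triangle x y z :
  pos_part (x - z) <= pos_part (x - y) + pos_part (y - z).
Proof.
rewrite /pos_part lg_leUx lg_addr_ge0 ?pos_part_ge0// andbT.
by rewrite -[x - z](subrKA y) lg_lerD ?le_pos_part.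
Qed.

(** For positive elements this is [lg_meet x y = 0], put as a condition on lower bounds so that it
    can be handled by translations alone. *)
Definition lg_disjoint x y := forall z, z <= x -> z <= y -> z <= 0.

Lemma lg_disjointC x y : lg_disjoint x y -> lg_disjoint y x.
Proof. by move=> xy z zy zx; apply: xy. Qed.

(** Since [pos_part (- x) <= p - x], a common lower bound [z] makes [p - z] an upper bound of [x]
    and [0]; hence [p <= p - z]. *)
Lemma pos_part_disjoint x : lg_disjoint (pos_part x) (pos_part (- x)).
Proof.
move=> z zx zNx; set p := pos_part x in zx *.
have pNx : pos_part (- x) <= p - x.
  rewrite /pos_part lg_leUx !lg_lerBrDl subrr addr0.
  by rewrite pos_part_ge0 le_pos_part.
have : p <= p - z.
  rewrite {1}/p /pos_part lg_leUx !lg_lerBrDl addr0 zx andbT addrC -lg_lerBrDl.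
  exact: le_trans zNx pNx.
by rewrite lg_lerBrDl addrC -{2}[p]addr0 lg_lerD2lE.
Qed.

(** If [u] is below [x] and [y + z], then [u - y] is below [x] and [z], so [u <= y], and the
    disjointness of [x] and [y] applies. *)
Lemma lg_disjointD x y z :
  0 <= y -> lg_disjoint x y -> lg_disjoint x z -> lg_disjoint x (y + z).
Proof.
move=> y0 xy xz u ux uyz; apply: xy => //.
have : u - y <= 0.
  apply: xz; last by rewrite lg_lerBlDl.
  by rewrite lg_lerBlDl -[u]add0r; apply: lg_lerD.
by rewrite lg_lerBlDl addr0.
Qed.

Lemma lg_disjointMn x y n : 0 <= y -> lg_disjoint x y -> lg_disjoint x (y *+ n).
Proof.
move=> y0 xy; elim: n => [|n IH]; first by rewrite mulr0n.
by rewrite mulrS; apply: lg_disjointD.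
Qed.

(** For [0 <= u], the l-ideal generated by [u]: the condition is |z| <= n u, without an absolute
    value. *)
Definition principal u : set G := [set z | exists n, - (u *+ n) <= z <= u *+ n].

Lemma principal_id u : 0 <= u -> principal u u.
Proof.
move=> u0; exists 1%N; rewrite mulr1n lexx andbT (le_trans _ u0)//.
by rewrite lg_lerNl oppr0.
Qed.

Lemma l_ideal_principal u : 0 <= u -> l_ideal (principal u).
Proof.
move=> u0.
have widen z n m : - (u *+ n) <= z <= u *+ n ->
    - (u *+ (n + m)) <= z <= u *+ (n + m).
  rewrite lg_lerNl [- (_ *+ (n + m)) <= _]lg_lerNl => /andP[h1 h2].
  by rewrite mulrnDr -[- z]addr0 -{2}[z]addr0 !lg_lerD// lg_mulrn_ge0.
split.
- by exists 0%N; rewrite mulr0n oppr0 lexx.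
- move=> x y [n /andP[x1 x2]] [m /andP[y1 y2]]; exists (n + m)%N.
  by rewrite mulrnDr opprD !lg_lerD// ?[- y <= _]lg_lerNl// -lg_lerNl opprK.
- move=> x y [n xn] [m ym]; exists (n + m)%N.
  have /andP[x1 x2] := widen _ _ m xn.
  have := widen _ _ n ym; rewrite addnC => /andP[y1 y2].
  rewrite lg_leUx x2 y2 !andbT; apply: le_trans x1 _.
  by have := lexx (lg_join x y); rewrite lg_leUx => /andP[].
- move=> x y [n xn] [m ym]; exists (n + m)%N.
  have /andP[x1 x2] := widen _ _ m xn.
  have := widen _ _ n ym; rewrite addnC => /andP[y1 y2].
  rewrite lg_lexI x1 y1 /=; apply: le_trans x2.
  by have := lexx (lg_meet x y); rewrite lg_lexI => /andP[].
- move=> x y z [n /andP[x1 x2]] [m /andP[z1 z2]] /andP[xy yz].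
  exists (n + m)%N; have /andP[x3 _] := widen _ _ m (introT andP (conj x1 x2)).
  have := widen _ _ n (introT andP (conj z1 z2)); rewrite addnC => /andP[_ z3].
  by rewrite (le_trans x3 xy) (le_trans yz z3).
Qed.

Lemma l_idealN (J : set G) x : l_ideal J -> J x -> J (- x).
Proof. by move=> lJ Jx; rewrite -sub0r; apply: l_idealB (l_ideal0 lJ) Jx. Qed.

Lemma l_idealD (J : set G) x y : l_ideal J -> J x -> J y -> J (x + y).
Proof.
by move=> lJ Jx Jy; rewrite -[y]opprK; apply: l_idealB => //; apply: l_idealN.
Qed.

Lemma principal_sub (J : set G) u : l_ideal J -> J u -> principal u `<=` J.
Proof.
move=> lJ Ju z [n].
have Jn : J (u *+ n).
  by elim: n => [|n IH]; [exact: l_ideal0|rewrite mulrS; apply: l_idealD].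
by apply: l_ideal_convex => //; apply: l_idealN.
Qed.

Lemma principal_fg u : 0 <= u -> fg_l_ideal (principal u).
Proof.
move=> u0; exists [set u]; first exact: finite_set1.
apply/seteqP; split=> [|z].
  move=> z uz A [lA uA]; apply: (principal_sub lA) uz; exact: uA.
by apply; split; [exact: l_ideal_principal|move=> _ ->; exact: principal_id].
Qed.

Lemma l_ideal_smallest (S : set G) : l_ideal (smallest (@l_ideal G) S).
Proof.
split.
- by move=> A [lA _]; apply: l_ideal0.
- by move=> x y hx hy A hA; apply: (l_idealB hA.1); [exact: hx|exact: hy].
- by move=> x y hx hy A hA; apply: (l_ideal_join hA.1); [exact: hx|exact: hy].
- by move=> x y hx hy A hA; apply: (l_ideal_meet hA.1); [exact: hx|exact: hy].
- by move=> x y z hx hz xyz A hA; apply: (l_ideal_convex hA.1 _ _ xyz);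
    [exact: hx|exact: hz].
Qed.

(** A finite generating set can be replaced by the sum of the absolute values of its members, with
    |x| written as [pos_part x + pos_part (- x)]. *)
Lemma fg_l_ideal_principal (J : set G) : fg_l_ideal J ->
  exists2 u, 0 <= u & J = principal u.
Proof.
case=> S finS ->; set K := smallest _ _.
have lK : l_ideal K by exact: l_ideal_smallest.
suff [u [u0 Ku Su]] : exists u, [/\ 0 <= u, K u & S `<=` principal u].
  exists u => //; apply/seteqP; split; last exact: principal_sub.
  by apply: smallest_sub => //; exact: l_ideal_principal.
have SK : S `<=` K by exact: sub_gen_smallest.
(* From here on [K] is any l-ideal containing the generators, so it stays fixed while the list of
   generators shrinks. *)
clearbody K; move: SK; case/finite_seqP: finS => s -> {S}.
elim: s => [_|x s IH sK]; first by exists 0; split=> //; exact: l_ideal0.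
have [|u [u0 Ku su]] := IH; first by move=> y ys; apply: sK; rewrite /= inE ys orbT.
have Kx : K x by apply: sK; rewrite /= mem_head.
have K0 := l_ideal0 lK.
pose v := pos_part x + pos_part (- x).
have v0 : 0 <= v by apply: lg_addr_ge0; exact: pos_part_ge0.
have w0 : 0 <= v + u by exact: lg_addr_ge0.
have lw := l_ideal_principal w0.
have w1 := principal_id w0.
exists (v + u); split=> //.
  by apply: l_idealD => //; apply: l_idealD => //; apply: l_ideal_join => //;
     apply: l_idealN.
have pv : principal (v + u) v.
  apply: (l_ideal_convex lw (l_ideal0 lw) w1).
  by rewrite v0 -{1}[v]addr0 lg_lerD2lE.
have pu : principal (v + u) u.
  apply: (l_ideal_convex lw (l_ideal0 lw) w1).
  by rewrite u0 addrC -{1}[u]addr0 lg_lerD2lE.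
move=> y /=; rewrite inE => /orP[/eqP->|ys]; last exact: (principal_sub lw pu) (su y ys).
apply: (l_ideal_convex lw (l_idealN lw pv) pv).
rewrite lg_lerNl -[- x]add0r -{2}[x]addr0.
by rewrite !lg_lerD ?pos_part_ge0 ?le_pos_part.
Qed.

Lemma principal_disjoint u v z : 0 <= u -> 0 <= v -> lg_disjoint u v ->
  principal u z -> principal v z -> z = 0.
Proof.
move=> u0 v0 uv [n /andP[z1 z2]] [m /andP[z3 z4]].
have h : lg_disjoint (u *+ n) (v *+ m).
  by apply/lg_disjointMn => //; apply/lg_disjointC/lg_disjointMn => //;
     exact: lg_disjointC.
by apply/le_anti; rewrite (h z)//= -[z]opprK -[0]oppr0 lg_lerNl !opprK h// lg_lerNl.
Qed.

Definition principal_idc u (u0 : 0 <= u) : Idc G :=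
  MkIdc (introT (asboolP _) (principal_fg u0)).

End AbelianLGroup.

(** Each [z] is the image of a principal l-ideal with positive generator [gen z], and [cv x y] is
    the image of the one generated by [pos_part (gen x - gen y)]. The three properties of this
    Cevian operation come from a <= b + (a - b)^+, from the disjointness of (a - b)^+ and (b - a)^+,
    and from the triangle inequality. *)
Lemma l_representable_cevian d (L : latticeType d) (A : lAlg) (h : L -> A) :
    l_representable L -> bounded_distributive_lattice A ->
    (forall x y, h (Order.join x y) = ljoin (h x) (h y)) ->
    (forall x y, h (Order.meet x y) = lmeet (h x) (h y)) ->
    (forall z, exists x, h x = z) ->
  exists cv : A -> A -> A,
  [/\ forall x y, ljoin x (ljoin y (cv x y)) = ljoin y (cv x y),
      forall x y, lmeet (cv x y) (cv y x) = lbot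
    & forall x y z, ljoin (cv x z) (ljoin (cv x y) (cv y z)) =
                    ljoin (cv x y) (cv y z)].
Proof.
move=> [G [phi [[psi phiK psiK] phi_mono]]] bA hU hI hsurj.
have idcP (J : Idc G) : exists u : {u : G | (0 <= u)%R},
    idc_set J = principal (proj1_sig u).
  have /asboolP/fg_l_ideal_principal[u u0 ->] := idc_fg J.
  by exists (exist _ u u0).
have lI (J : Idc G) : l_ideal (idc_set J).
  by have [u ->] := idcP J; apply: l_ideal_principal (proj2_sig u).
pose I (u : G) (u0 : (0 <= u)%R) := psi (principal_idc u0).
have /choice[gen genP] z : exists u : {u : G | (0 <= u)%R},
    h (I _ (proj2_sig u)) = z.
  have [x <-] := hsurj z; have [u Ju] := idcP (phi x); exists u.
  congr h; rewrite -[RHS]phiK; congr psi.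
  by apply/val_inj; rewrite /= Ju.
have I_le u (u0 : (0 <= u)%R) q : idc_set (phi q) u -> (I u u0 <= q)%O.
  move=> qu; rewrite -phi_mono psiK; apply/le_idcE.
  exact: principal_sub.
have leI u (u0 : (0 <= u)%R) q : (I u u0 <= q)%O -> idc_set (phi q) u.
  rewrite -phi_mono psiK => /le_idcE; apply; exact: principal_id.
(* No description of joins of l-ideals is required: the l-ideal of the join contains [v] and [w],
   hence [v + w], hence [u] by convexity. *)
have joinI u v w (u0 : (0 <= u)%R) (v0 : (0 <= v)%R) (w0 : (0 <= w)%R) :
    (u <= v + w)%R -> (I u u0 <= I v v0 `|` I w w0)%O.
  move=> uvw; apply: I_le; set q := Order.join _ _.
  apply: (l_ideal_convex (lI _) (l_ideal0 (lI _))) (introT andP (conj u0 uvw)).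
  by apply: l_idealD => //; apply: leI; rewrite /q ?leUl ?leUr.
pose cv x y := h (I _ (pos_part_ge0 (proj1_sig (gen x) - proj1_sig (gen y))%R)).
exists cv; split=> [x y|x y|x y z].
- rewrite -{1}(genP x) -{1 3}(genP y) -!hU; congr h.
  apply: join_r; apply: joinI.
  by rewrite -lg_lerBlDl le_pos_part.
- rewrite -hI; set q := Order.meet _ _.
  (* The l-ideal of [q] lies in two principal l-ideals with disjoint generators, so it contains only
     [0], and [q] is least in [L]. *)
  have q0 p : (q <= p)%O.
    rewrite -phi_mono; apply/le_idcE => z qz.
    suff -> : z = 0%R by exact: l_ideal0.
    apply: (principal_disjoint (pos_part_ge0 _) (pos_part_ge0 _) (@pos_part_disjoint _ _)).
    + have : (q <= I _ (pos_part_ge0 (proj1_sig (gen x) - proj1_sig (gen y))%R))%O.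
        exact: leIl.
      by rewrite -phi_mono psiK => /le_idcE; apply.
    + have : (q <= I _ (pos_part_ge0 (proj1_sig (gen y) - proj1_sig (gen x))%R))%O.
        exact: leIr.
      by rewrite -phi_mono psiK opprB => /le_idcE; apply.
  (* Surjectivity provides a preimage [p] of [lbot], and [q <= p] forces [h q = lbot]. *)
  have [p hp] := hsurj lbot; have := hI q p; rewrite (meet_l (q0 p)) hp => ->.
  by rewrite (bdl_meetC bA) -{1}(bdl_join0 bA (h q)) (bdl_meetK bA).
- rewrite -!hU; congr h; apply: join_r; apply: joinI.
  exact: pos_part_triangle.
Qed.

(** * Terms and free algebras *)

Fixpoint term_vars (X : Type) (t : lterm X) : set X :=
  match t with
  | TVar x => [set x]
  | TJoin s t | TMeet s t | TDiff s t => term_vars s `|` term_vars t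
  | TBot | TTop => set0
  end.

Lemma term_vars_finite (X : Type) (t : lterm X) : finite_set (term_vars t).
Proof.
by elim: t => //= s IHs t IHt;
  rewrite finite_setU.
Qed.

Lemma lhom_leval (X : Type) (A B : lAlg) (h : A -> B) (v : X -> A) (t : lterm X) :
  lhom h -> h (leval v t) = leval (h \o v) t.
Proof.
case=> hU hI hD h0 h1.
by elim: t => //= s IHs t IHt; rewrite ?hU ?hI ?hD IHs IHt.
Qed.

(** The range of a homomorphism is a subalgebra, so only the variables that occur in the term
    matter. This confines the differences to the faces of the cube. *)
Lemma leval_lhom_range (X : Type) (A B : lAlg) (h : A -> B) (v : X -> B)
    (t : lterm X) :
    lhom h -> (forall x, term_vars t x -> exists a, h a = v x) ->
  exists a, h a = leval v t.
Proof.
case=> hU hI hD h0 h1.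
elim: t => [x|s IHs t IHt|s IHs t IHt|s IHs t IHt||] /= vP.
- exact: vP.
- have [|a <-] := IHs; first by move=> x xs; apply: vP; left.
  have [|b <-] := IHt; first by move=> x xt; apply: vP; right.
  by exists (ljoin a b).
- have [|a <-] := IHs; first by move=> x xs; apply: vP; left.
  have [|b <-] := IHt; first by move=> x xt; apply: vP; right.
  by exists (lmeet a b).
- have [|a <-] := IHs; first by move=> x xs; apply: vP; left.
  have [|b <-] := IHt; first by move=> x xt; apply: vP; right.
  by exists (ldiff a b).
- by exists lbot.
- by exists ltop.
Qed.

Lemma variety_lembedding (V : lAlg -> Prop) (A B : lAlg) (h : A -> B) :
  is_variety V -> lembedding h -> V B -> V A.
Proof.
move=> [E VE] [hom_h inj_h] /VE VB; apply/VE => s t Est v; apply: inj_h.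
by rewrite !lhom_leval//; apply: VB.
Qed.

(** The elements given by terms form a subalgebra [S], which lies in [V]. The map from [F] to [S]
    extending [eta], followed by the inclusion, fixes the generators, so by uniqueness it is the
    identity. *)
Lemma free_generated (V : lAlg -> Prop) (I : Type) (F : lAlg) (eta : I -> F) :
  is_variety V -> is_free V eta -> forall x, exists t, leval eta t = x.
Proof.
move=> Vvar [VF univ].
pose gen x := exists t, leval eta t = x.
have genU x y : gen x -> gen y -> gen (ljoin x y).
  by move=> [s <-] [t <-]; exists (TJoin s t).
have genI x y : gen x -> gen y -> gen (lmeet x y).
  by move=> [s <-] [t <-]; exists (TMeet s t).
have genD x y : gen x -> gen y -> gen (ldiff x y).
  by move=> [s <-] [t <-]; exists (TDiff s t).
have gen0 : gen lbot by exists (TBot _).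
have gen1 : gen ltop by exists (TTop _).
have geneta i : gen (eta i) by exists (TVar i).
pose op (o : F -> F -> F) (oP : forall x y, gen x -> gen y -> gen (o x y))
    (x y : {x | gen x}) : {x | gen x} :=
  exist _ (o (sval x) (sval y)) (oP _ _ (svalP x) (svalP y)).
pose S := MkLAlg (op _ genU) (op _ genI) (op _ genD)
  (exist _ _ gen0) (exist _ _ gen1).
have emb : @lembedding S F sval 
  by split=> [|[x gx] [y gy] /= xy]; [split|exact: eq_exist].
have [h [[hom_h h_eta] _]] := univ S (fun i => exist _ _ (geneta i))
  (variety_lembedding Vvar emb VF).
have [id' [_ uniq]] := univ F eta VF.
move=> x; have [t tx] := svalP (h x); exists t; rewrite tx.
have id'E : id' = sval \o h.
  apply: uniq; split=> [|i]; last by rewrite /= h_eta.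
  by split=> [y z|y z|y z||] /=; rewrite ?(lhom_join hom_h) ?(lhom_meet hom_h)
     ?(lhom_diff hom_h) ?(lhom_bot hom_h) ?(lhom_top hom_h).
have : sval \o h = id by rewrite -id'E; apply: uniq.
by move=> /(congr1 (@^~ x)).
Qed.

(** The two differences serve as witnesses: [b] is the join of [lmeet b a], which [a] absorbs, and
    [ldiff b a]. *)
Lemma variety0_completely_normal (A : lAlg) : variety0 A -> completely_normal A.
Proof.
move=> [bA dA dI] a b; exists (ldiff a b), (ldiff b a).
have joinD (x y : A) : ljoin x (ldiff y x) = ljoin x y.
  by rewrite -{2}(dA y x) (bdl_joinA bA) (bdl_meetC bA y) (bdl_joinK bA).
by split=> //; rewrite !joinD// (bdl_joinC bA (ldiff a b)) joinD (bdl_joinC bA).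
Qed.

(** * The cube *)

Definition mid : chain3 := Ordinal (isT : 1 < 3)%N.

Lemma chain3_max (y : chain3) :
  Order.join ord_max (Order.join mid y) = Order.join mid y -> y = ord_max.
Proof.
move=> /join_idPr; rewrite lexU !leEord /= => y2.
by apply/val_inj/anti_leq; rewrite y2 -ltnS ltn_ord.
Qed.

Lemma chain3_meet_max (y z : chain3) :
  z = ord_max -> Order.meet y z = ord0 -> y = ord0.
Proof.
by move=> -> h; rewrite -h; apply/esym/meet_idPl; rewrite leEord -ltnS ltn_ord.
Qed.

(* The last coordinates of [cube_a p12], [cube_c p23] and [cube_b p13] are forced
   to be [0], [0] and [1]. *)
Lemma cube_no_cevian (p12 p21 p13 p23 p32 : chain3sq)
    (u1 := cube_a (cube_f mid)) (u2 := cube_a (cube_g mid))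
    (u3 := cube_c (cube_g mid)) :
    Order.join u1 (Order.join u3 (cube_b p13)) = Order.join u3 (cube_b p13) ->
    Order.join u2 (Order.join u1 (cube_a p21)) = Order.join u1 (cube_a p21) ->
    Order.meet (cube_a p12) (cube_a p21) = \bot%O ->
    Order.join u3 (Order.join u2 (cube_c p32)) = Order.join u2 (cube_c p32) ->
    Order.meet (cube_c p23) (cube_c p32) = \bot%O ->
    Order.join (cube_b p13) (Order.join (cube_a p12) (cube_c p23)) =
      Order.join (cube_a p12) (cube_c p23) ->
  False.
Proof.
case: p12 p21 p13 p23 p32 => [x12 y12] [x21 y21] [x13 y13] [x23 y23] [x32 y32].
move=> H13 H21 D12 H32 D23 H.
(* Here [u1] = (2,2,1,1), [u2] = (2,1,2,1) and [u3] = (1,2,2,1). In each case the coordinate chosen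
   is one where the inequality reads 2 <= 1 \/ y; the disjointness hypotheses then make [y12] and
   [y23] vanish. *)
have x13E : x13 = ord_max := chain3_max (congr1 (fun p => p.1.1.1) H13).
have y21E : y21 = ord_max := chain3_max (congr1 (fun p => p.1.2) H21).
have y32E : y32 = ord_max := chain3_max (congr1 (fun p => p.1.1.2) H32).
have y12E : y12 = ord0 := chain3_meet_max y21E (congr1 (fun p => p.1.2) D12).
have y23E : y23 = ord0 := chain3_meet_max y32E (congr1 (fun p => p.1.1.2) D23).
(* The last coordinate now reads 1 <= 0 \/ 0. *)
move: (congr1 snd H) => /=; rewrite x13E y12E y23E.
by move=> /join_idPr; rewrite lexU !leEord.
Qed.

(** * Evaluating the free algebra in the cube *)

Lemma free_no_cevian (c : cube_expansion) (V : lAlg -> Prop) (I : Type)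
    (F : lAlg) (eta : I -> F) (cv : F -> F -> F) :
    is_variety V -> V (cube_top c) -> is_free V eta -> card_ge_aleph2 I ->
    (forall x y, ljoin x (ljoin y (cv x y)) = ljoin y (cv x y)) ->
    (forall x y, lmeet (cv x y) (cv y x) = lbot) ->
    (forall x y z, ljoin (cv x z) (ljoin (cv x y) (cv y z)) =
                   ljoin (cv x y) (cv y z)) ->
  False.
Proof.
move=> Vvar Vtop Ffree I2 cv_join cv_meet cv_trans.
have /choice[term termP] := free_generated Vvar Ffree.
pose supp x := term_vars (term x).
(* Including [i] and [j] makes the free triple distinct; including the supports of both differences
   handles the two orders of the arguments at once. *)
pose P i j := [set i; j] `|` (supp (cv (eta i) (eta j)) `|` supp (cv (eta j) (eta i))).
have finP i j : finite_set (P i j).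
  by rewrite /P !finite_setU; do !split; try exact: finite_set1; exact: term_vars_finite.
have [i [j [k [nk nj ni]]]] := free_triple I2 finP.
have ki : k <> i by move=> ki; apply: nk; left; left.
have kj : k <> j by move=> kj; apply: nk; left; right.
have ji : j <> i by move=> ji; apply: nj; left; left.
pose u1 : cube_top c := cube_a (cube_f mid).
pose u2 : cube_top c := cube_a (cube_g mid).
pose u3 : cube_top c := cube_c (cube_g mid).
pose v x : cube_top c := if `[< x = i >] then u1 else
  if `[< x = j >] then u2 else if `[< x = k >] then u3 else lbot.
have vi : v i = u1 by rewrite /v asboolT.
have vj : v j = u2 by rewrite /v asboolF// asboolT.
have vk : v k = u3 by rewrite /v asboolF// asboolF// asboolT.
have [h [[hom_h h_eta] _]] := Ffree.2 _ v Vtop.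
(* All generators other than [i], [j], [k] go to [lbot], which is in every range; so only these
   three need preimages, and only when they occur in the term of [x]. *)
have range (A : lAlg) (g : A -> cube_top c) x : lhom g ->
    (supp x i -> exists a, g a = u1) -> (supp x j -> exists a, g a = u2) ->
    (supp x k -> exists a, g a = u3) -> exists a, g a = h x.
  move=> hom_g g1 g2 g3; rewrite -[x]termP lhom_leval//.
  rewrite (_ : h \o eta = v); last exact/funext.
  apply: leval_lhom_range => // l; rewrite /v.
  do 3! (case: asboolP => [->//|_]).
  by exists lbot; apply: lhom_bot.
(* By commutativity of the cube, [u1] lies in the ranges of [cube_a] and [cube_b], [u2] in those of
   [cube_a] and [cube_c], and [u3] in those of [cube_b] and [cube_c]. Each range thus misses only
   the generator excluded from the support. *)
have range_a x : ~ supp x k -> exists p, cube_a p = h x.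
  move=> xk; apply: (range _ _ _ (emb_12_123 c).1) => // _.
  - by exists (cube_f mid).
  - by exists (cube_g mid).
have range_b x : ~ supp x j -> exists p, cube_b p = h x.
  move=> xj; apply: (range _ _ _ (emb_13_123 c).1) => // _.
  - by exists (cube_f mid).
  - by exists (cube_g mid).
have range_c x : ~ supp x i -> exists p, cube_c p = h x.
  move=> xi; apply: (range _ _ _ (emb_23_123 c).1) => // _.
  - by exists (cube_f mid).
  - by exists (cube_g mid).
have [p12 p12E] : exists p, cube_a p = h (cv (eta i) (eta j)).
  by apply: range_a => s; apply: nk; right; left.
have [p21 p21E] : exists p, cube_a p = h (cv (eta j) (eta i)).
  by apply: range_a => s; apply: nk; right; right.
have [p13 p13E] : exists p, cube_b p = h (cv (eta i) (eta k)).
  by apply: range_b => s; apply: nj; right; left.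
have [p23 p23E] : exists p, cube_c p = h (cv (eta j) (eta k)).
  by apply: range_c => s; apply: ni; right; left.
have [p32 p32E] : exists p, cube_c p = h (cv (eta k) (eta j)).
  by apply: range_c => s; apply: ni; right; right.
have hJ x y : ljoin (h x) (ljoin (h y) (h (cv x y))) = ljoin (h y) (h (cv x y)).
  by rewrite -!(lhom_join hom_h) cv_join.
have hM x y : lmeet (h (cv x y)) (h (cv y x)) = lbot.
  by rewrite -(lhom_meet hom_h) cv_meet (lhom_bot hom_h).
have := cv_trans (eta i) (eta j) (eta k).
move=> /(congr1 h); rewrite !(lhom_join hom_h) -p12E -p13E -p23E.
apply: (@cube_no_cevian p12 p21 p13 p23 p32).
- by have := hJ (eta i) (eta k); rewrite !h_eta -p13E vi vk.
- by have := hJ (eta j) (eta i); rewrite !h_eta -p21E vi vj.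
- by have := hM (eta i) (eta j); rewrite -p12E -p21E.
- by have := hJ (eta k) (eta j); rewrite !h_eta -p32E vj vk.
- by have := hM (eta j) (eta k); rewrite -p23E -p32E.
Qed.

Theorem theorem7p5 (c : cube_expansion) (V : lAlg -> Prop)
    (V_variety : is_variety V)
    (V_top : V (cube_top c))
    (V_sub : forall A : lAlg, V A -> variety0 A)
    (I : Type) (F : lAlg) (eta : I -> F) (F_free : is_free V eta) :
  (bounded_distributive_lattice F /\ completely_normal F) /\
  (card_ge_aleph2 I ->
   forall (d : Order.disp_t) (L : latticeType d),
     l_representable L -> ~ homomorphic_image L F).
Proof.
have F0 := V_sub F F_free.1; have F_bdl := variety0_lattice F0.
split; first by split=> //; apply: variety0_completely_normal.
move=> I2 d L repL [h [hU hI hsurj]].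
have [cv [cv_join cv_meet cv_trans]] :=
  l_representable_cevian repL F_bdl hU hI hsurj.
exact: free_no_cevian V_variety V_top F_free I2 cv_join cv_meet cv_trans.
Qed.
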